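(* Every original setup gives rise to a new setup: if $(G,Z,R,N,\mu,\delta)$ is an original setup, then $G$, $Z$ and $\delta$ (regarded as a mapping $G/Z\times G/Z\to Z$ via the natural projection $G/Z\to G/R$) form a new setup.
   Context: Conventions: $x^y=y^{-1}xy$, $[x,y]=x^{-1}y^{-1}xy$; $G'$ is the derived subgroup, $Z(G)$ the center. An original setup $(G,Z,R,N,\mu,\delta)$ consists of a group $G$ with subgroups satisfying $Z\le R\le N\unlhd G$, $Z\le Z(G)$, $R\unlhd G$, $G'\le N$, $N/R\le Z(G/R)$; a mapping $\mu:G/R\times G/R\to Z$ (written $\mu(x,y)$ for $\mu(xR,yR)$) with $\mu(1,x)=\mu(x,1)=1$ for every $x\in G$; and the mapping $\delta:G/R\times G/R\to Z$ defined by $\delta(x,y)=\mu(x,y)\mu(y,x)^{-1}$, such that $\mu(xy,z)=\mu(x,z)\mu(y,z)$ and $\mu(x,yz)=\mu(x,y)\mu(x,z)$ whenever $x,y,z\in G$ and $\{x,y,z\}\cap N\neq\emptyset$, and $z^{yx}\delta([z,y],x)=z^{xy}\delta([z,x],y)$ for every $x,y,z\in G$. A new setup $(G,Z,\delta)$ consists of a group $G$, a subgroup $Z\le Z(G)$ and a mapping $\delta:G/Z\times G/Z\to Z$ (written $\delta(x,y)$ for $\delta(xZ,yZ)$) such that: $\delta(x,x)=1$ for every $x\in G$; $\delta(x,y)=\delta(y,x)^{-1}$ for every $x,y\in G$; $\delta(xy,z)=\delta(x,z)\delta(y,z)$ whenever $x,y,z\in G$ and $\{x,y,z\}\cap G'\neq\emptyset$;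 $z^{yx}\delta([z,y],x)=z^{xy}\delta([z,x],y)$ for every $x,y,z\in G$. *)

(* Defs.v *)
From mathcomp Require Import all_boot.
From mathcomp Require Import boolp classical_sets.

Set Implicit Arguments.
Unset Strict Implicit.
Unset Printing Implicit Defensive.

Local Open Scope classical_set_scope.
Local Open Scope group_scope.

(* Groups are arbitrary, possibly infinite, [groupType]s, and subgroups are
   [set]s satisfying the library's [group_closed].  The library's conventions
   are x ^ y = y^-1 * x * y and [~ x, y] = x^-1 * y^-1 * x * y. *)

Section Groups.
Variable G : groupType.
Implicit Types (H K : set G) (x y z : G).

Definition subgroup H : Prop := group_closed (mem H).

Definition normal_subgroup H : Prop :=
  subgroup H /\ forall x y, H x -> H (x ^ y).

Definition group_center : set G := [set z | forall x, commute z x].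

Definition derived_subgroup : set G :=
  smallest subgroup [set z | exists x y, z = [~ x, y]].

Definition lcoset_set H x : set G := [set x * h | h in H].

(* G/H as the type of left cosets of H; it is meant for a subgroup H. *)
Definition quotient H : Type := set_type (range (lcoset_set H)).

Lemma mem_lcoset_set H x : lcoset_set H x \in range (lcoset_set H).
Proof. by apply/mem_set; exists x. Qed.

Definition coset H x : quotient H := SigSub (mem_lcoset_set H x).

Definition coset_repr H (C : quotient H) : G := xget 1 (val C).

(* The map xK |-> xH, meant for subgroups K `<=` H, where it does not depend
   on the chosen representative: see [quotient_projE]. *)
Definition quotient_proj K H (C : quotient K) : quotient H :=
  coset H (coset_repr C).

Lemma quotient_projE K H x : subgroup K -> subgroup H -> K `<=` H ->
  quotient_proj H (coset K x) = coset H x.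
Proof.
move=> [K1 _] sH KH; have HM := group_closedM sH; have HV := group_closedV sH.
have [k Kk xk] : lcoset_set K x (coset_repr (coset K x)).
  apply: (@xgetPex _ 1 (val (coset K x))); exists x.
  by exists 1; [exact/set_mem|rewrite mulg1].
have Hk : k \in mem H by apply/mem_set/KH.
apply: val_inj; rewrite /= -xk; apply/seteqP; split=> _ [h Hh <-].
  by exists (k * h); [exact/set_mem/(HM _ _ Hk)/mem_set|rewrite mulgA].
exists (k^-1 * h); first exact/set_mem/(HM _ _ (HV _ Hk))/mem_set.
by rewrite -mulgA mulVKg.
Qed.

End Groups.

Arguments group_center : clear implicits.
Arguments derived_subgroup : clear implicits.

Section Setups.
Variable G : groupType.

(* Mappings into Z are represented as G-valued maps whose values lie in Z. *)

Record original_setup (Z R N : set G)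
    (mu delta : quotient R -> quotient R -> G) : Prop := OriginalSetup {
  os_Z_subgroup : subgroup Z;
  os_R_normal : normal_subgroup R;
  os_N_normal : normal_subgroup N;
  os_Z_sub_R : Z `<=` R;
  os_R_sub_N : R `<=` N;
  os_Z_central : Z `<=` group_center G;
  os_derived_sub_N : derived_subgroup G `<=` N;
  (* N/R <= Z(G/R), the product in G/R being (xR)(yR) = (xy)R. *)
  os_N_central_mod_R : forall n x : G,
    N n -> coset R (n * x) = coset R (x * n);
  os_mu_Z : forall C D, Z (mu C D);
  os_mu1g : forall x, mu (coset R 1) (coset R x) = 1;
  os_mug1 : forall x, mu (coset R x) (coset R 1) = 1;
  os_deltaE : forall C D, delta C D = mu C D * (mu D C)^-1;
  os_muMl : forall x y z : G, [set x; y; z] `&` N !=set0 ->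
    mu (coset R (x * y)) (coset R z) =
    mu (coset R x) (coset R z) * mu (coset R y) (coset R z);
  os_muMr : forall x y z : G, [set x; y; z] `&` N !=set0 ->
    mu (coset R x) (coset R (y * z)) =
    mu (coset R x) (coset R y) * mu (coset R x) (coset R z);
  os_deltaJ : forall x y z : G,
    z ^ (y * x) * delta (coset R [~ z, y]) (coset R x) =
    z ^ (x * y) * delta (coset R [~ z, x]) (coset R y)
}.

Record new_setup (Z : set G) (delta : quotient Z -> quotient Z -> G) : Prop :=
    NewSetup {
  ns_Z_subgroup : subgroup Z;
  ns_Z_central : Z `<=` group_center G;
  ns_delta_Z : forall C D, Z (delta C D);
  ns_deltagg : forall x, delta (coset Z x) (coset Z x) = 1;
  ns_deltaV : forall x y,
    delta (coset Z x) (coset Z y) = (delta (coset Z y) (coset Z x))^-1;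
  ns_deltaMl : forall x y z : G,
    [set x; y; z] `&` derived_subgroup G !=set0 ->
    delta (coset Z (x * y)) (coset Z z) =
    delta (coset Z x) (coset Z z) * delta (coset Z y) (coset Z z);
  ns_deltaJ : forall x y z : G,
    z ^ (y * x) * delta (coset Z [~ z, y]) (coset Z x) =
    z ^ (x * y) * delta (coset Z [~ z, x]) (coset Z y)
}.

End Setups.

Arguments original_setup {G} Z R N mu delta.
Arguments new_setup {G} Z delta.

(* Main.v *)
Require Import Defs.
From mathcomp Require Import all_boot.
From mathcomp Require Import boolp classical_sets.

(** Since [Z `<=` R], [delta] on cosets of [Z] evaluates at [xZ] and [yZ] to
    [mu(x, y) mu(y, x)^-1], so the conditions of a new setup become statements
    about [mu].  This expression is the antisymmetrization of [mu], hence it is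
    trivial on the diagonal and is inverted by swapping its arguments.  It is
    multiplicative in the first argument as soon as [mu] is multiplicative in
    both, because the four values of [mu] involved are central and can be
    regrouped; this happens whenever one of the elements is in [G'], as
    [G'] is contained in [N].  The conjugation identity is literally the same
    in both setups. *)

(** For a multiplicative [mu] with central values, this is the step from
    [mu(xy, z) mu(z, xy)^-1] to the product of the antisymmetrizations: [b] and
    [d] are the values at [(y, z)] and [(z, y)], while [c] is that at [(z, x)]
    and has to be moved past both. *)
Lemma divMM_central (G : groupType) (a b c d : G) : group_center G c ->
  (a * b * (c * d)^-1 = a * c^-1 * (b * d^-1))%g.
Proof.
move=> cc; have cV (t : G) : commute (c^-1)%g t.
  exact/commute_sym/commuteV/commute_sym.
by rewrite invgM -!mulgA -(cV (d^-1)%g) (mulgA b) -(cV b) !mulgA.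
Qed.

Theorem proposition2p3 (G : groupType) (Z R N : set G)
    (mu delta : quotient R -> quotient R -> G) :
  original_setup Z R N mu delta ->
  new_setup Z (fun C D : quotient Z =>
    delta (quotient_proj R C) (quotient_proj R D)).
Proof.
case=> sZ [sR _] _ ZR _ Zcent G'N _ muZ _ _ deltaE muMl muMr deltaJ.
have projE x : quotient_proj R (coset Z x) = coset R x.
  exact: quotient_projE.
split=> //.
- move=> C D; rewrite deltaE.
  apply/set_mem; apply: (group_closedM sZ); first exact/mem_set/muZ.
  exact/(group_closedV sZ)/mem_set/muZ.
- by move=> x; rewrite deltaE mulgV.
- by move=> x y; rewrite !deltaE invgM invgK.
- move=> x y z /(subset_nonempty (setIS G'N)) xyzN.
  (* Expanding in the second argument concerns the triple (z, x, y), which has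
     the same underlying set. *)
  have zxyN : nonempty (setI [set z; x; y]%classic N).
    case: xyzN => t [xyzt Nt]; exists t; split=> //.
    by case: xyzt => [[]|] ->; [left; right|right|left; left].
  rewrite !projE !deltaE muMl // muMr //.
  exact/divMM_central/Zcent/muZ.
- by move=> x y z; rewrite !projE.
Qed.
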